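(* Let $\mathcal{P}$ be a finite classical polar space of rank $d$. Every degree one Cameron-Liebler set of generators in $\mathcal{P}$ with parameter $1$ is a point-pencil, i.e. the set of all generators of $\mathcal{P}$ through some fixed point of $\mathcal{P}$.
   Context: The finite classical polar spaces of rank $d$ are $Q^+(2d-1,q)$, $H(2d-1,q)$ ($q$ a square), $W(2d-1,q)$, $Q(2d,q)$, $H(2d,q)$ ($q$ a square), $Q^-(2d+1,q)$; generators are totally isotropic subspaces of maximal projective dimension $d-1$. The parameter $e$ (every $(d-2)$-space lies in exactly $q^e+1$ generators) is $0,\tfrac12,1,1,\tfrac32,2$ respectively. With $A$ the real point-generator incidence matrix, a set $\mathcal{L}$ of generators with characteristic vector $\chi$ is a degree one Cameron-Liebler set if $\chi\in\mathrm{im}(A^T)$; its parameter is $x=|\mathcal{L}|/\prod_{k=0}^{d-2}(q^{e+k}+1)$. *)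

(* Defs.v *)
From HB Require Import structures.
From mathcomp Require Import all_boot all_order all_algebra.
From mathcomp Require Import reals exp.

Set Implicit Arguments.
Unset Strict Implicit.
Unset Printing Implicit Defensive.

Import GRing.Theory.
Local Open Scope ring_scope.

(* Gives access to {vspace vT} as a subtype of a matrix type, whence finiteness. *)
Import VectorInternalTheory.

HB.instance Definition _ (F : finFieldType) (vT : vectType F) :=
  [Countable of {vspace vT} by <:].
HB.instance Definition _ (F : finFieldType) (vT : vectType F) :=
  [Finite of {vspace vT} by <:].

(* The six families, in the order
   Q^+(2d-1,q), H(2d-1,q), W(2d-1,q), Q(2d,q), H(2d,q), Q^-(2d+1,q). *)
Variant polar_type :=
  | Hyperbolic | HermitianOdd | Symplectic
  | Parabolic | HermitianEven | Elliptic.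

(* Vector space dimension, i.e. one more than the projective dimension. *)
Definition ambient_dim (t : polar_type) (d : nat) : nat :=
  match t with
  | Hyperbolic | HermitianOdd | Symplectic => d.*2
  | Parabolic | HermitianEven => d.*2.+1
  | Elliptic => d.*2.+2
  end.

Definition polar_e (R : realType) (t : polar_type) : R :=
  match t with
  | Hyperbolic => 0
  | HermitianOdd => 1 / 2
  | Symplectic => 1
  | Parabolic => 1
  | HermitianEven => 3 / 2
  | Elliptic => 2
  end.

Section QuadraticForms.
Variables (F : fieldType) (V : lmodType F).

Definition is_quadratic (Q : V -> F) : Prop :=
  (forall a v, Q (a *: v) = a ^+ 2 * Q v) /\
  exists B : {biscalar V}, forall u v, Q (u + v) = Q u + Q v + B u v.

(* In even characteristic the polar form of a nonsingular form may be
   degenerate (parabolic case), so nonsingularity only asks that Q have no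
   nontrivial zero in the radical of its polar form. *)
Definition nonsingular (Q : V -> F) : Prop :=
  forall v, Q v = 0 -> (forall u, Q (v + u) - Q v - Q u = 0) -> v = 0.

End QuadraticForms.

Section PolarSpaces.
Variables (F : finFieldType) (n : nat).

Variant polar_form :=
  | QuadraticForm of 'rV[F]_n -> F
  | AlternatingForm of {skew_symmetric 'rV[F]_n}
  | HermitianForm (theta : {rmorphism F -> F}) of
      {hermitian_sym 'rV[F]_n for theta}.

Variable phi : polar_form.

Definition totally_isotropic (U : {vspace 'rV[F]_n}) : bool :=
  match phi with
  | QuadraticForm Q => [forall v, (v \in U) ==> (Q v == 0)]
  | AlternatingForm B => (U <= orthov B U)%VS
  | HermitianForm _ H => (U <= orthov H U)%VS
  end.

Definition polar_rank : nat :=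
  \max_(U : {vspace 'rV[F]_n} | totally_isotropic U) \dim U.

Definition points : {set {vspace 'rV[F]_n}} :=
  [set U | totally_isotropic U & \dim U == 1%N].

Definition generators : {set {vspace 'rV[F]_n}} :=
  [set U | totally_isotropic U & \dim U == polar_rank].

Definition point_pencil (p : {vspace 'rV[F]_n}) : {set {vspace 'rV[F]_n}} :=
  [set U in generators | (p <= U)%VS].

Section CameronLiebler.
Variable R : realType.

Definition incidence_mx : 'M[R]_(#|points|, #|generators|) :=
  \matrix_(i, j) ((enum_val i <= enum_val j)%VS)%:R.

Definition char_vec (L : {set {vspace 'rV[F]_n}}) : 'cV[R]_#|generators| :=
  \col_j (enum_val j \in L)%:R.

Definition degree_one_CL (L : {set {vspace 'rV[F]_n}}) : Prop :=
  L \subset generators /\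
  exists w : 'cV[R]_#|points|, char_vec L = incidence_mx^T *m w.

End CameronLiebler.
End PolarSpaces.

(* [is_psymplectic] asks for a nondegenerate form which is moreover alternating
   in characteristic 2; in odd characteristic skew-symmetric forms are
   alternating.  In the Hermitian case |F| = r^2 and the companion automorphism
   is x |-> x^r; it is this condition that rules out symmetric bilinear forms
   (theta = id). *)
Definition defines_type (F : finFieldType) (t : polar_type) (n : nat)
    (phi : polar_form F n) : Prop :=
  match t, phi with
  | (Hyperbolic | Parabolic | Elliptic), QuadraticForm Q =>
      is_quadratic Q /\ nonsingular Q
  | Symplectic, AlternatingForm B => is_psymplectic B
  | (HermitianOdd | HermitianEven), HermitianForm theta H =>
      (exists2 r : nat, #|F| = (r ^ 2)%N & forall x, theta x = x ^+ r) /\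
      is_unitary H
  | _, _ => False
  end.

(* The three quadratic types are told apart by the ambient dimension in terms
   of the rank (Witt index) d. *)
Definition classical_polar_space (F : finFieldType) (t : polar_type) (d : nat)
    (phi : polar_form F (ambient_dim t d)) : Prop :=
  defines_type t phi /\ polar_rank phi = d.

Definition CL_parameter (R : realType) (F : finFieldType) (t : polar_type)
    (d n : nat) (L : {set {vspace 'rV[F]_n}}) : R :=
  #|L|%:R / \prod_(k < d.-1) (#|F|%:R `^ (polar_e R t + k%:R) + 1).

(* Main.v *)
(** The characteristic function of [L] is [f tau = \sum_(v in tau) g v] for a
    weight [g] on singular vectors, of total weight the parameter, that is 1.
    The number of generators [tau] through a totally isotropic [U] with
    [tau :&: pi = U :&: pi], for a generator [pi], only depends on the dimension
    of [U].  Hence summing [f] over the generators disjoint from [pi] gives a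
    multiple of [1 - f pi]: any two elements of [L] meet.  Likewise, for a point
    [u] of [pi], summing [f] over the generators meeting [pi] exactly in [u]
    gives [K u - c * f pi] with [K u] independent of [pi].  Averaging over the
    points of some [pi \in L] yields [u] with [K u > c].  Suppose
    that some [sigma \in L] misses [u] and let [sigma'] be the generator
    [u + (u^perp :&: sigma)].  A generator meeting [sigma'] exactly in [u] is
    disjoint from [sigma], hence not in [L]; so [K u = c * f sigma' <= c], a
    contradiction.
    So every element of [L] contains [u], and the cardinalities agree. *)

Require Import Defs.
From HB Require Import structures.
From mathcomp Require Import all_boot all_order all_algebra finfield.
From mathcomp Require Import reals exp.
From mathcomp Require Import ring zify.

Set Implicit Arguments.
Unset Strict Implicit.
Unset Printing Implicit Defensive.

Import Order.TTheory GRing.Theory Num.Theory.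
Local Open Scope ring_scope.

(** * Cardinalities of subspaces and of fibres of semilinear functionals *)

Section FiniteSubspaces.
Variables (F : finFieldType) (n : nat).
Implicit Types (U : {vspace 'rV[F]_n}) (u v : 'rV[F]_n).

Lemma card_rowspace U : #|U| = (#|F| ^ \dim U)%N.
Proof. exact: (@card_vspace F 'rV[F]_n (Vector.class 'rV[F]_n) U). Qed.

Lemma card_rowspaceS U W : (U <= W)%VS -> (#|U| <= #|W|)%N.
Proof. by move=> UW; apply/subset_leq_card/subsetP/subvP. Qed.

Lemma card_rowspaceD U W : (U <= W)%VS ->
  #|[pred v | (v \in W) && (v \notin U)]| = (#|F| ^ \dim W - #|F| ^ \dim U)%N.
Proof.
move=> UW; rewrite -!card_rowspace -(cardID (mem U) (mem W)).
rewrite [X in (X + _)%N](_ : _ = #|U|); last first.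
  by apply: eq_card => v; rewrite !inE andb_idl // => /(subvP UW).
by rewrite addKn; apply: eq_card => v; rewrite !inE andbC.
Qed.

Lemma card_rowspace_neq0 (R : nzRingType) U :
  #|[pred v in U | v != 0]|%:R = #|F|%:R ^+ \dim U - 1 :> R.
Proof.
have -> : #|[pred v in U | v != 0]|
  = #|[pred v | (v \in U) && (v \notin 0%VS)]|.
  by apply: eq_card => v; rewrite !inE memv0.
rewrite card_rowspaceD ?sub0v // dimv0 expn0 natrB ?natrX //.
by rewrite expn_gt0 ltnW ?finNzRing_gt1.
Qed.

Lemma vline_eqP u v : u != 0 -> u \in <[v]>%VS -> <[u]>%VS = <[v]>%VS.
Proof.
move=> u0 uv; apply/eqP; rewrite eqEdim -memvE uv !dim_vline u0.
by case: (v != 0).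
Qed.

(** An endomorphism of a finite field is bijective, so a semilinear functional that is not
    identically zero on [U] maps [U] onto [F]. Being additive, it has the translates of its kernel
    as fibres, hence [#|F|] fibres of equal size. *)
Lemma semilinear_fiber_card (theta : {rmorphism F -> F}) U
    (f : 'rV[F]_n -> F) (t : F) :
  (forall a u v, f (a *: u + v) = theta a * f u + f v) ->
  (exists2 u, u \in U & f u != 0) ->
  (#|F| * #|[pred u in U | f u == t]|)%N = #|U|.
Proof.
move=> fP [u0 u0U fu0].
have f0 : f 0 = 0.
  by have := fP 1 0 0; rewrite scale1r addr0 rmorph1 mul1r => /eqP;
    rewrite -[X in X == _]addr0 eq_sym (inj_eq (addrI _)) => /eqP.
have fD u v : f (u + v) = f u + f v.
  by have := fP 1 u v; rewrite scale1r rmorph1 mul1r.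
have fB u v : f (u - v) = f u - f v by apply/eqP;
  rewrite eq_sym subr_eq -fD subrK.
have [th thK thK'] : bijective theta by apply/injF_bij/fmorph_inj.
have onto s : exists2 u, u \in U & f u = s.
  exists (th (s / f u0) *: u0); first exact: memvZ.
  by rewrite -[_ *: _]addr0 fP f0 addr0 thK' divfK.
have fib s : #|[pred u in U | f u == s]| = #|[pred u in U | f u == 0]|.
  have [w wU fw] := onto s.
  rewrite -(card_image (can_inj (addrK w)) [pred u in U | f u == 0]).
  apply: eq_card => u; rewrite !inE.
  apply/andP/imageP => [[uU /eqP fu]|[v]].
    by exists (u - w); rewrite ?subrK // !inE rpredB // fB fu fw subrr /=.
  by rewrite !inE => /andP[vU /eqP fv] ->; rewrite rpredD // fD fv fw add0r.
have -> : #|U| = (\sum_(s : F) #|[pred u in U | f u == s]|)%N.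
  rewrite -sum1_card (partition_big f predT) //=.
  by apply: eq_bigr => s _; rewrite -sum1_card.
by rewrite (eq_bigr (fun=> #|[pred u in U | f u == t]|)) ?sum_nat_const // =>
  s _; rewrite !fib.
Qed.

End FiniteSubspaces.

(* [Z] is the set of singular vectors and [B] the (polar) form.  The last axiom
   is a uniform substitute for the classification: modulo a subspace not
   orthogonal to it, every coset has the same proportion [1 / rho] of singular
   vectors. *)
Record polar_geometry (F : finFieldType) (n : nat) (theta : {rmorphism F -> F})
    (B : 'rV[F]_n -> 'rV[F]_n -> F) (Z : pred 'rV[F]_n) (rho : nat) : Prop := {
  pg_linear : forall a u v w, B (a *: u + v) w = a * B u w + B v w;
  pg_semilinear : forall w a u v, B w (a *: u + v) = theta a * B w u + B w v;
  pg_reflexive : forall u v, (B u v == 0) = (B v u == 0);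
  pg_Z0 : Z 0;
  pg_ZZ : forall a u, Z u -> Z (a *: u);
  pg_ZD : forall u v, Z u -> Z v -> B u v = 0 -> Z (u + v);
  pg_self : forall u, Z u -> B u u = 0;
  pg_nondeg : forall v, Z v -> (forall u, B v u = 0) -> v = 0;
  pg_coset : forall (U : {vspace 'rV[F]_n}) v,
    {in U, forall x, Z x} -> {in U &, forall x y, B x y = 0} ->
    (exists2 x, x \in U & B v x != 0) ->
    (rho * #|[pred x in U | Z (v + x)%R]|)%N = #|U|
}.

(** * Orthogonality and singular subspaces *)

Section PolarGeometry.
Variables (F : finFieldType) (n : nat) (theta : {rmorphism F -> F}).
Variables (B : 'rV[F]_n -> 'rV[F]_n -> F) (Z : pred 'rV[F]_n) (rho : nat).
Hypothesis pg : polar_geometry theta B Z rho.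
Local Notation V := 'rV[F]_n.
Implicit Types (U W X : {vspace V}) (u v x : V).

(** The span serves only to obtain a [{vspace V}]: linearity of [B] on the left makes the listed
    vectors closed under combinations, so nothing is added ([perpP]). *)
Definition perp U : {vspace V} :=
  <<[seq v <- enum V | [forall u in U, B v u == 0%R]]>>%VS.

Definition singular_subspace U : bool :=
  [forall u in U, Z u && [forall v in U, B u v == 0]].

Lemma polar0l u : B 0 u = 0.
Proof.
have := pg_linear pg 1 0 0 u; rewrite scale1r addr0 mul1r => /eqP.
by rewrite -[X in X == _]addr0 eq_sym (inj_eq (addrI _)) => /eqP.
Qed.

Lemma polarDl u v w : B (u + v) w = B u w + B v w.
Proof. by have := pg_linear pg 1 u v w; rewrite scale1r mul1r. Qed.

Lemma polarZl a u w : B (a *: u) w = a * B u w.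
Proof. by have := pg_linear pg a u 0 w; rewrite addr0 polar0l addr0. Qed.

Lemma polarC0 u v : B u v = 0 -> B v u = 0.
Proof. by move/eqP; rewrite (pg_reflexive pg) => /eqP. Qed.

Lemma polarDr0 u v w : B w u = 0 -> B w v = 0 -> B w (u + v) = 0.
Proof. by move=> /polarC0 wu /polarC0 wv; apply: polarC0;
  rewrite polarDl wu wv addr0. Qed.

Lemma polarZr0 a u w : B w u = 0 -> B w (a *: u) = 0.
Proof. by move=> /polarC0 wu; apply: polarC0; rewrite polarZl wu mulr0. Qed.

Lemma perpP U v : reflect {in U, forall u, B v u = 0} (v \in perp U).
Proof.
apply: (iffP idP) => [vU u uU | vU]; last first.
  by apply: memv_span; rewrite mem_filter mem_enum andbT;
    apply/'forall_implyP => u /vU->.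
move: vU; rewrite /perp; set s := [seq _ <- _ | _] => vU.
rewrite (@coord_span _ _ _ (in_tuple s) _ vU);
  apply: (big_ind (fun x => B x u = 0)).
- exact: polar0l.
- by move=> x y xu yu; rewrite polarDl xu yu addr0.
move=> i _; rewrite polarZl.
have : s`_i \in s by rewrite mem_nth.
by rewrite mem_filter => /andP[/'forall_implyP/(_ _ uU)/eqP-> _]; rewrite mulr0.
Qed.

Lemma mem_perp_line v u : (v \in perp <[u]>) = (B v u == 0).
Proof.
apply/perpP/eqP => [|vu x /vlineP[a ->]]; first by apply; exact: memv_line.
exact: polarZr0.
Qed.

Lemma mem_perpC v u : (v \in perp <[u]>) = (u \in perp <[v]>).
Proof. by rewrite !mem_perp_line (pg_reflexive pg). Qed.

Lemma perpD U W : perp (U + W) = (perp U :&: perp W)%VS.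
Proof.
apply/vspaceP => v; rewrite memv_cap;
  apply/perpP/andP => [vUW|[/perpP vU /perpP vW] x].
  by split; apply/perpP => x xU; apply: vUW; apply: subvP xU;
    rewrite ?addvSl ?addvSr.
by case/memv_addP => [y /vU yv] [z /vW zv] ->; apply: polarDr0.
Qed.

Lemma perpS U W : (U <= W)%VS -> (perp W <= perp U)%VS.
Proof. by move=> /subvP UW; apply/subvP => v /perpP vW;
  apply/perpP => u /UW /vW. Qed.

Lemma sub_perpC U W : (U <= perp W)%VS -> (W <= perp U)%VS.
Proof.
move=> /subvP UW; apply/subvP => w wW; apply/perpP => u uU; apply: polarC0.
by move/perpP: (UW _ uU); apply.
Qed.

(* Count the pairs [(x, u)] with [B x u = 0] in two ways. *)
Lemma card_perp_exchange X U :
  (#|(X :&: perp U)%VS| * #|U| = #|(U :&: perp X)%VS| * #|X|)%N.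
Proof.
pose P (X U : {vspace V}) := (\sum_(x in X) #|[pred u in U | B x u == 0%R]|)%N.
have PC : P X U = P U X.
  rewrite /P (eq_bigr (fun x => \sum_(u in U | B x u == 0%R) 1)%N); last first.
    by move=> x _; rewrite sum1_card.
  rewrite (exchange_big_dep (mem U)) /=; last by move=> x u _ /andP[].
  apply: eq_bigr => u uU; rewrite sum1_card; apply: eq_card => x.
  by rewrite !inE uU /= (pg_reflexive pg).
(* A vector of [Y] in [perp W] is paired with all of [W]. Any other one is paired with the kernel of
   a nonzero functional on [W], a fraction [1 / #|F|] of it. *)
have PE Y W : (#|F| * P Y W = #|F| * #|(Y :&: perp W)%VS| * #|W|
                + (#|Y| - #|(Y :&: perp W)%VS|) * #|W|)%N.
  have -> : (#|Y| - #|(Y :&: perp W)%VS|)%N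
            = #|[pred y in Y | y \notin perp W]|.
    rewrite -(cardID (mem (perp W)) (mem Y)).
    rewrite (eq_card (_ : _ =i (Y :&: perp W)%VS)); last first.
      by move=> y; rewrite !inE memv_cap.
    by rewrite addKn; apply: eq_card => y; rewrite !inE andbC.
  rewrite /P (bigID (mem (perp W))) /= mulnDr.
  congr addn.
    rewrite (eq_bigr (fun=> #|W|)); last first.
      move=> y /andP[_ /perpP yW]; apply: eq_card => u; rewrite !inE.
      by apply: andb_idr => /yW ->.
    rewrite sum_nat_const mulnA; congr (_ * _ * _)%N.
    by apply: eq_card => y; rewrite unfold_in [RHS]memv_cap.
  rewrite big_distrr /= (eq_bigr (fun=> #|W|)) ?sum_nat_const //.
  move=> y /andP[_ yW]; apply: (semilinear_fiber_card 0 (pg_semilinear pg y)).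
  apply/exists_inP; apply: contraNT yW;
    rewrite negb_exists_in => /forall_inP yW.
  by apply/perpP => u /yW; rewrite negbK => /eqP.
have := PE X U; rewrite PC PE.
have q1 : (1 < #|F|)%N := finNzRing_gt1 F.
have := card_rowspaceS (capvSl X (perp U)).
have := card_rowspaceS (capvSl U (perp X)).
(* Both expansions contain [#|X| * #|U|]; what remains carries the common factor [#|F| - 1], which
   is [q.+1] after writing [#|F|] as [q.+2]. *)
move: #|(X :&: _)%VS| #|(U :&: _)%VS| #|X| #|U| #|F| q1 => a b x u [|[|q]] // _.
move=> /subnKC <- /subnKC <-; rewrite !addKn.
move: (u - b)%N (x - a)%N => {}u {}x E.
have : (q.+1 * (a * u) = q.+1 * (b * x))%N by lia.
by move/eqP; rewrite eqn_pmul2l // => /eqP; lia.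
Qed.

Lemma dim_perp_exchange X U :
  (\dim (X :&: perp U) + \dim U = \dim (U :&: perp X) + \dim X)%N.
Proof.
have := card_perp_exchange X U; rewrite !card_rowspace -!expnD => /eqP.
by rewrite eqn_exp2l ?finNzRing_gt1 // => /eqP.
Qed.


Lemma singular_subspaceP U :
  reflect ({in U, forall x, Z x} /\ {in U &, forall x y, B x y = 0})
          (singular_subspace U).
Proof.
apply: (iffP forall_inP) => [sU | [ZU BU] x xU].
  split=> [x /sU /andP[] // | x y xU yU].
  by case/andP: (sU x xU) => _ /forall_inP/(_ y yU)/eqP.
by rewrite ZU //=; apply/forall_inP => y yU; rewrite BU.
Qed.

Lemma singular_sub_perp U : singular_subspace U -> (U <= perp U)%VS.
Proof.
by case/singular_subspaceP => _ BU; apply/subvP => x xU; apply/perpP => y;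
  apply: BU.
Qed.

Lemma singular_subspaceS U W :
  (U <= W)%VS -> singular_subspace W -> singular_subspace U.
Proof.
move=> /subvP UW /singular_subspaceP[ZW BW]; apply/singular_subspaceP.
by split=> [x /UW /ZW | x y /UW xW /UW yW] //; apply: BW.
Qed.

Lemma singular_subspaceD U W : singular_subspace U -> singular_subspace W ->
  (W <= perp U)%VS -> singular_subspace (U + W)%VS.
Proof.
move=> sU sW WU; have /singular_subspaceP[ZU BU] := sU.
have /singular_subspaceP[ZW BW] := sW; have UW := sub_perpC WU.
have UUW : (U + W <= perp (U + W))%VS.
  by rewrite perpD subv_cap !subv_add !singular_sub_perp // WU UW.
apply/singular_subspaceP; split=> [x /memv_addP[y yU [z zW ->]] | x y xUW yUW].
  apply: (pg_ZD pg); [exact: ZU | exact: ZW |].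
  by move/subvP/(_ _ yU)/perpP: UW; apply.
by move/subvP/(_ _ xUW)/perpP: UUW; apply.
Qed.

Lemma singular_line v : Z v -> singular_subspace <[v]>%VS.
Proof.
move=> Zv; apply/singular_subspaceP; split=> [x /vlineP[a ->] | x y].
  exact: (pg_ZZ pg).
move=> /vlineP[a ->] /vlineP[b ->]; rewrite polarZl polarZr0 ?mulr0 //.
exact: (pg_self pg).
Qed.

(** The radical of [B] can be nonzero (parabolic quadrics in characteristic 2), but it contains no
    nonzero singular vector. It therefore meets [U] trivially, and the exchange formula with the
    full space loses nothing. *)
Lemma dim_perp U : singular_subspace U -> (\dim (perp U) + \dim U = n)%N.
Proof.
move=> /singular_subspaceP[ZU _]; have := dim_perp_exchange fullv U.
rewrite capfv dimvf /dim /= mul1n => ->.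
suff -> : (U :&: perp fullv = 0)%VS by rewrite dimv0.
apply/eqP; rewrite -subv0; apply/subvP => v; rewrite memv_cap memv0.
case/andP=> vU /perpP vV; apply/eqP/(pg_nondeg pg); first exact: ZU.
by move=> u; apply: vV; apply: memvf.
Qed.

(** * Maximal singular subspaces *)

Variable d : nat.
Hypothesis singular_dim_le : forall U, singular_subspace U -> (\dim U <= d)%N.
Hypothesis singular_dim_max : exists2 U, singular_subspace U & \dim U = d.

Definition maximals : {set {vspace V}} :=
  [set U | singular_subspace U & \dim U == d].
Implicit Types (pi sigma tau : {vspace V}).

Lemma maximalsP pi :
  reflect (singular_subspace pi /\ \dim pi = d) (pi \in maximals).
Proof. by rewrite inE; apply: (iffP andP) => -[? /eqP]. Qed.

Lemma maximal_Z pi v : pi \in maximals -> v \in pi -> Z v.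
Proof. by case/maximalsP=> /singular_subspaceP[Zpi _] _ /Zpi. Qed.

Lemma maximal_perp pi u v : pi \in maximals -> u \in pi -> v \in pi ->
  v \in perp <[u]>.
Proof.
case/maximalsP=> /singular_subspaceP[_ Bpi] _ upi vpi.
by rewrite mem_perp_line Bpi.
Qed.

(** Cutting [pi] with [perp U] costs [\dim U - \dim (U :&: perp pi)] dimensions. Adding [U] regains
    at least as many, because [U :&: X] lies in [U :&: perp pi]. *)
Lemma maximal_proj pi U : pi \in maximals -> singular_subspace U ->
  (U + (pi :&: perp U))%VS \in maximals.
Proof.
case/maximalsP=> spi dpi sU; set X := (pi :&: perp U)%VS.
have sUX : singular_subspace (U + X)%VS.
  by apply: singular_subspaceD (capvSr _ _) => //;
    apply: singular_subspaceS spi; apply: capvSl.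
apply/maximalsP; split=> //; apply/eqP; rewrite eqn_leq singular_dim_le //=.
have := dimv_sum_cap U X; have := dim_perp_exchange pi U; rewrite -/X dpi.
have : (\dim (U :&: X) <= \dim (U :&: perp pi))%N.
  rewrite dimvS // capvS //; apply: subv_trans (singular_sub_perp spi).
  exact: capvSl.
lia.
Qed.

Lemma maximal_extension U : singular_subspace U ->
  exists2 pi, pi \in maximals & (U <= pi)%VS.
Proof.
move=> sU; have [pi spi dpi] := singular_dim_max.
exists (U + (pi :&: perp U))%VS; last exact: addvSl.
by apply: maximal_proj => //; apply/maximalsP.
Qed.

Lemma perp_maximal pi v : pi \in maximals -> Z v -> v \in perp pi -> v \in pi.
Proof.
case/maximalsP=> spi dpi Zv vpi.
have := singular_dim_le (singular_subspaceD spi (singular_line Zv) _).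
rewrite -memvE => /(_ vpi); rewrite -dpi => le.
suff -> : pi = (pi + <[v]>)%VS by apply: subvP (addvSr _ _) _ (memv_line v).
by apply/eqP; rewrite eqEdim addvSl.
Qed.

(** * Counting singular vectors and maximal singular subspaces *)

(* Count the pairs [(v, x)], [x \in pi], with [v + x] singular in two ways. *)
Lemma card_singular_perp pi U : pi \in maximals -> (U <= pi)%VS ->
  (rho * (#|F| ^ d * #|[pred v in perp U | Z v]|)
   = rho * (#|F| ^ d * #|F| ^ d)
     + (#|F| ^ (n - \dim U) - #|F| ^ (n - d)) * #|F| ^ d)%N.
Proof.
move=> mpi Upi; have [spi dpi] := maximalsP _ mpi.
have sU := singular_subspaceS Upi spi.
have [Zpi Bpi] := singular_subspaceP _ spi.
have piU : (pi <= perp U)%VS := subv_trans (singular_sub_perp spi) (perpS Upi).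
have -> : (n - \dim U = \dim (perp U))%N by have := dim_perp sU; lia.
have -> : (n - d = \dim (perp pi))%N by have := dim_perp spi; lia.
rewrite -(card_rowspaceD (perpS Upi)) -dpi -!card_rowspace.
have <- : (\sum_(v in perp U) #|[pred x in pi | Z (v + x)%R]|
          = #|pi| * #|[pred v in perp U | Z v]|)%N.
  rewrite (eq_bigr (fun v => \sum_(x in pi | Z (v + x)%R) 1)%N); last first.
    by move=> v _; rewrite sum1_card.
  rewrite (exchange_big_dep (mem pi)) /=; last by move=> v x _ /andP[].
  rewrite -sum_nat_const; apply: eq_bigr => x xpi; rewrite sum1_card.
  rewrite -(card_image (can_inj (addrK x)) [pred v | _ & _]);
    apply: eq_card => v.
  have xU : x \in perp U := subvP piU x xpi.
  apply/imageP/andP => [[y] | [vU Zv]].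
    by rewrite !inE => /andP[yU /andP[_ Zy]] ->; rewrite rpredD.
  by exists (v - x); rewrite ?subrK // !inE subrK rpredB //= xpi.
(* If [v] is in [perp pi] and [v + x] is singular, maximality puts [v] in [pi], and then every [x]
   counts. If [v] is not in [perp pi], [pg_coset] gives [#|pi| / rho] choices of [x]. *)
rewrite (bigID (mem (perp pi))) /= mulnDr; congr addn.
  rewrite (bigID (mem pi)) /= [X in (_ + X)%N]big1 ?addn0 => [|v]; last first.
    case/andP=> /andP[vU vpi] /negP vNpi; apply: eq_card0 => x; rewrite !inE.
    apply/negP => /andP[xpi Zvx]; apply: vNpi.
    rewrite -[v](addrK x) rpredB //; apply: perp_maximal => //.
    by rewrite rpredD // (subvP (singular_sub_perp spi)).
  congr muln; rewrite -sum_nat_const; apply: eq_big => [v | v /andP[_ vpi]].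
    apply: andb_idl => vpi; rewrite (subvP piU) //=.
    exact: (subvP (singular_sub_perp spi)).
  by apply: eq_card => x; rewrite !inE; apply: andb_idr => xpi;
    apply/Zpi/rpredD.
rewrite big_distrr /= (eq_bigr (fun=> #|pi|)) ?sum_nat_const //.
move=> v /andP[_ vpi]; apply: (pg_coset pg) => //.
apply/exists_inP; apply: contraNT vpi;
  rewrite negb_exists_in => /forall_inP vpi.
by apply/perpP => x /vpi; rewrite negbK => /eqP.
Qed.

(** Two counts in one: [W = 0] imposes no condition and leaves all maximal subspaces through [U],
    while a maximal [W] selects those that meet it only in [U :&: W]. *)
Definition generators_over U W : {set {vspace V}} :=
  [set tau in maximals | (U <= tau)%VS & (tau :&: W <= U)%VS].

Lemma mem_generators_over U W tau : (tau \in generators_over U W) =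
  [&& tau \in maximals, (U <= tau)%VS & (tau :&: W <= U)%VS].
Proof. exact: in_set. Qed.

Variables (R : realType) (s : R).
Hypothesis d_gt0 : (0 < d)%N.
(** Here [s] stands for [q ^ e]. With [rho] equal to [q], [sqrt q] or 1, the equation says that [n]
    is [2d + e], [2d + e - 1/2] or [2d + e - 1]: the quadratic, Hermitian and symplectic cases. *)
Hypothesis s_rho : s * #|F|%:R ^+ d.-1 * rho%:R = #|F|%:R ^+ (n - d).
Local Notation q := (#|F|%:R : R).

Let q_gt1 : 1 < q. Proof. by rewrite ltr1n finNzRing_gt1. Qed.
Let q_gt0 : 0 < q. Proof. exact: lt_trans q_gt1. Qed.

Let rho_gt0 : (0 < rho%:R :> R).
Proof.
rewrite lt0r ler0n andbT; apply/eqP => rho0; move: s_rho.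
by rewrite rho0 mulr0 => /eqP; rewrite eq_sym expf_eq0 (gt_eqF q_gt0) andbF.
Qed.

Let s_gt0 : 0 < s.
Proof.
have : 0 < s * q ^+ d.-1 * rho%:R by rewrite s_rho exprn_gt0.
by rewrite pmulr_lgt0 // pmulr_lgt0 // exprn_gt0.
Qed.

Lemma card_singular_perpR U : singular_subspace U ->
  #|[pred v in perp U | Z v]|%:R
    = q ^+ d + (q ^+ (d - \dim U) - 1) * (s * q ^+ d.-1).
Proof.
move=> sU; have [pi mpi Upi] := maximal_extension sU.
have [spi dpi] := maximalsP _ mpi.
have := card_singular_perp mpi Upi; move: #|[pred v in _ | _]| => N.
have k_le := singular_dim_le sU; have := dim_perp spi; rewrite dpi => dn.
have nd : (d <= n)%N by lia.
move=> /(congr1 (fun m => m%:R : R)).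
rewrite !(natrM, natrD, natrX) natrB; last first.
  by rewrite leq_exp2l ?finNzRing_gt1 // leq_sub2l.
rewrite !natrX -s_rho => E.
apply: (mulfI (lt0r_neq0 rho_gt0));
  apply: (mulfI (lt0r_neq0 (exprn_gt0 d q_gt0))).
rewrite mulrCA E.
have -> : (n - \dim U = (n - d) + (d - \dim U))%N by lia.
by rewrite exprD -s_rho; ring.
Qed.

(** Count the pairs of a [tau] in [generators_over U W] and a vector [v] of [tau] outside [U]. Such
    a [v] is never in [U + W], and for an admissible [v] the spaces [tau] containing it are exactly
    those over [U + <[v]>]. *)
Lemma generators_over_step U W (c : R) : singular_subspace U ->
  (forall v, Z v -> v \in perp U -> v \notin (U + W)%VS ->
     #|generators_over (U + <[v]>) W|%:R = c) ->
  #|generators_over U W|%:R * (q ^+ d - q ^+ \dim U)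
    = #|[pred v in perp U | Z v && (v \notin (U + W)%VS)]|%:R * c.
Proof.
move=> sU cnt.
have -> : #|generators_over U W|%:R * (q ^+ d - q ^+ \dim U)
  = \sum_(tau in generators_over U W) \sum_(v in tau | v \notin U) 1.
  rewrite mulr_natl -sumr_const; apply: eq_bigr => tau.
  rewrite inE => /and3P[/maximalsP[stau dtau] Utau _].
  rewrite sumr_const card_rowspaceD // dtau natrB ?natrX //.
  by rewrite leq_exp2l ?finNzRing_gt1 // singular_dim_le.
rewrite (exchange_big_dep (fun v =>
  (v \in perp U) && (Z v && (v \notin (U + W)%VS)))) /=.
  rewrite mulr_natl -sumr_const; apply: eq_bigr => v /and3P[vU Zv vUW].
  rewrite sumr_const -(cnt v Zv vU vUW); congr (_%:R); apply: eq_card => tau.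
  have vNU : v \notin U by apply: contra vUW; apply: subvP (addvSl _ _) v.
  rewrite [LHS]unfold_in !inE vNU andbT subv_add -memvE;
    case: (singular_subspace tau && _) => //=.
  case: (boolP (U <= tau)%VS) => //= Utau; rewrite andbC;
    case: (boolP (v \in tau)) => //= vtau.
  apply/idP/idP => [sub | /subvP sub]; first exact: subv_trans sub (addvSl _ _).
  (* A common vector of [tau] and [W] has the form [u + a v]; a nonzero [a] would put [v] in
     [U + W]. *)
  apply/subvP => y yW; case/memv_addP: (sub y yW) => u uU [z /vlineP[a ->] yE].
  have [a0 | a0] := eqVneq a 0; first by rewrite yE a0 scale0r addr0.
  case/negP: vUW; have -> : v = a^-1 *: (- u + y) by rewrite yE addKr scalerK.
  by move: yW; rewrite memv_cap => /andP[_ yW];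
    rewrite memvZ // memv_add ?rpredN.
move=> tau v; rewrite inE => /and3P[mtau Utau sub] /andP[vtau vU].
have [stau _] := maximalsP _ mtau.
rewrite (maximal_Z mtau) // (subvP (perpS Utau)) 
  ?(subvP (singular_sub_perp stau)) //=.
apply: contra vU => /memv_addP[u uU [w wW vE]]; rewrite vE rpredD //.
apply: (subvP sub); rewrite memv_cap wW andbT.
by have -> : w = v - u by [rewrite vE addrC addKr];
  rewrite rpredB // (subvP Utau).
Qed.

Lemma generators_over_full U W : singular_subspace U -> \dim U = d ->
  #|generators_over U W| = 1%N.
Proof.
move=> sU dU; rewrite (_ : generators_over U W = [set U]) ?cards1 //.
apply/setP => tau; rewrite !inE;
  apply/and3P/eqP => [[/andP[_ /eqP dtau] Utau _] | ->].
  by apply/eqP; rewrite eq_sym eqEdim Utau dtau dU /=.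
by rewrite sU dU eqxx subvv capvSl.
Qed.

Let generators_over_extend U W v :
  singular_subspace U -> Z v -> v \in perp U -> v \notin (U + W)%VS ->
  singular_subspace (U + <[v]>)%VS /\ \dim (U + <[v]>) = (\dim U).+1.
Proof.
move=> sU Zv vU vUW; split.
  by apply: singular_subspaceD; rewrite ?singular_line // -memvE.
have vNU : v \notin U by apply: contra vUW; apply: subvP (addvSl _ _) v.
rewrite dimv_disjoint_sum ?dim_vline.
  by rewrite (contraNneq _ vNU) ?addn1 // => ->; rewrite mem0v.
apply/eqP; rewrite -subv0; apply/subvP => x; rewrite memv_cap memv0.
case/andP=> xU /vlineP[a xE]; have [a0 | a0] := eqVneq a 0.
  by rewrite xE a0 scale0r.
by case/negP: vNU; rewrite -(scalerK a0 v) -xE memvZ.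
Qed.

(** Induction on the codimension [m + 1] of [U] in a maximal subspace. The singular vectors of
    [perp U] inside [U + pi] form the maximal subspace of [maximal_proj], so exactly [q ^+ d] are
    excluded, and the step contributes the factor [s * q ^+ m]. *)
Lemma card_generators_opposite U pi : singular_subspace U -> pi \in maximals ->
  #|generators_over U pi|%:R = \prod_(j < d - \dim U) (s * q ^+ j).
Proof.
move=> sU mpi; move Dm: (d - \dim U)%N => m.
elim: m U sU Dm => [|m IHm] U sU Dm.
  rewrite big_ord0 generators_over_full //.
  by apply/eqP; rewrite eqn_leq singular_dim_le //= -subn_eq0 Dm.
have ext v : Z v -> v \in perp U -> v \notin (U + pi)%VS ->
    #|generators_over (U + <[v]>) pi|%:R = \prod_(j < m) (s * q ^+ j).
  move=> Zv vU vUW.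
  have [sUv dUv] := generators_over_extend sU Zv vU vUW.
  by apply: IHm => //; rewrite dUv subnS Dm.
have := generators_over_step sU ext; move: ext => _.
have dE : d = (\dim U + m.+1)%N by lia.
have mproj := maximal_proj mpi sU.
have -> : #|[pred v in perp U | Z v && (v \notin (U + pi)%VS)]|%:R
          = #|[pred v in perp U | Z v]|%:R - q ^+ d.
  have -> : q ^+ d = #|(U + (pi :&: perp U))%VS|%:R.
    by rewrite card_rowspace natrX; case/maximalsP: mproj => _ ->.
  rewrite -(cardID (mem (U + pi)%VS) [pred v in perp U | Z v]) natrD addrAC.
  rewrite [X in _ - X](_ :
    _ = #|[predI [pred v in perp U | Z v] & (U + pi)%VS]|%:R).
    by rewrite subrr add0r; congr (_%:R); apply: eq_card => v; rewrite !inE;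
      case: (v \in perp U); case: (Z v); rewrite ?andbT ?andbF.
  congr (_%:R); apply: eq_card => v;
    rewrite (vspace_modl _ (singular_sub_perp sU)).
  rewrite [LHS]memv_cap !inE andbC; case: (boolP (v \in perp U)) => //= vU.
  apply/idP/andP => [vUpi | [] //]; split=> //; apply: (maximal_Z mproj).
  by rewrite (vspace_modl _ (singular_sub_perp sU)) memv_cap vUpi.
rewrite card_singular_perpR // Dm big_ord_recr /=.
have -> : q ^+ d = q ^+ \dim U * q ^+ m.+1 by rewrite dE exprD.
have -> : q ^+ d.-1 = q ^+ \dim U * q ^+ m by rewrite dE addnS exprD.
set P := \prod_(_ < _) _ => E.
have qm : q ^+ m.+1 - 1 != 0 by rewrite subr_eq0 gt_eqF // exprn_egt1.
apply: (mulIf qm); apply: (mulfI (lt0r_neq0 (exprn_gt0 (\dim U) q_gt0))).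
by rewrite mulrCA mulrBr mulr1 E; ring.
Qed.

(** The same induction with [W = 0]: only the [q ^+ \dim U] vectors of [U] are excluded, which turns
    the factor into [1 + s * q ^+ m]. *)
Lemma card_generators_through U : singular_subspace U ->
  #|generators_over U 0|%:R = \prod_(j < d - \dim U) (1 + s * q ^+ j).
Proof.
move=> sU; move Dm: (d - \dim U)%N => m.
elim: m U sU Dm => [|m IHm] U sU Dm.
  rewrite big_ord0 generators_over_full //.
  by apply/eqP; rewrite eqn_leq singular_dim_le //= -subn_eq0 Dm.
have ext v : Z v -> v \in perp U -> v \notin (U + 0)%VS ->
    #|generators_over (U + <[v]>) 0|%:R = \prod_(j < m) (1 + s * q ^+ j).
  move=> Zv vU vUW.
  have [sUv dUv] := generators_over_extend sU Zv vU vUW.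
  by apply: IHm => //; rewrite dUv subnS Dm.
have := generators_over_step sU ext; move: ext => _.
have dE : d = (\dim U + m.+1)%N by lia.
rewrite addv0.
have -> : #|[pred v in perp U | Z v && (v \notin U)]|%:R
          = #|[pred v in perp U | Z v]|%:R - q ^+ \dim U.
  rewrite -natrX -card_rowspace.
  rewrite -(cardID (mem U) [pred v in perp U | Z v]) natrD addrAC.
  rewrite [X in _ - X](_ : _ = #|[predI [pred v in perp U | Z v] & U]|%:R).
    by rewrite subrr add0r; congr (_%:R); apply: eq_card => v; rewrite !inE;
      case: (v \in perp U); case: (Z v); rewrite ?andbT ?andbF.
  congr (_%:R); apply: eq_card => v; rewrite !inE; apply/esym;
    apply: andb_idl => vU.
  rewrite (subvP (singular_sub_perp sU)) //=.
  by have /singular_subspaceP[ZU _] := sU; apply: ZU.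
rewrite card_singular_perpR // Dm big_ord_recr /=.
have -> : q ^+ d = q ^+ \dim U * q ^+ m.+1 by rewrite dE exprD.
have -> : q ^+ d.-1 = q ^+ \dim U * q ^+ m by rewrite dE addnS exprD.
set P := \prod_(_ < _) _ => E.
have qm : q ^+ m.+1 - 1 != 0 by rewrite subr_eq0 gt_eqF // exprn_egt1.
apply: (mulIf qm); apply: (mulfI (lt0r_neq0 (exprn_gt0 (\dim U) q_gt0))).
by rewrite mulrCA mulrBr mulr1 E; ring.
Qed.

(** The number of maximal subspaces through [U] that meet a given one only inside [U], when [U] has
    codimension [k] in a maximal subspace. *)
Let opposite_number k : R := \prod_(j < k) (s * q ^+ j).

Let opposite_number_gt0 k : 0 < opposite_number k.
Proof. by apply: prodr_gt0 => j _; rewrite mulr_gt0 ?exprn_gt0. Qed.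

Lemma generators_over_line0 v :
  generators_over <[v]> 0 = [set tau in maximals | v \in tau].
Proof. by apply/setP => tau;
  rewrite mem_generators_over [RHS]in_set capv0 sub0v andbT -memvE. Qed.

Lemma card_generators_opposite_line v pi : Z v -> v != 0 -> pi \in maximals ->
  #|generators_over <[v]> pi|%:R = opposite_number d.-1.
Proof.
move=> Zv v0 mpi; rewrite card_generators_opposite ?singular_line //.
by rewrite dim_vline v0 subn1.
Qed.

(** * Weighted counts for a degree one set *)

Section CameronLieblerSet.
Variables (L : {set {vspace V}}) (g : V -> R).
Hypothesis L_maximal : L \subset maximals.
Hypothesis g_support : forall v, g v != 0 -> Z v && (v != 0).
Hypothesis g_sum : {in maximals, forall tau,
  \sum_(v in tau) g v = (tau \in L)%:R}.
Hypothesis L_card : #|L|%:R = \prod_(j < d.-1) (1 + s * q ^+ j).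

Let eq_weighted_sum (a b : V -> R) : (forall v, Z v -> v != 0 -> a v = b v) ->
  \sum_v g v * a v = \sum_v g v * b v.
Proof.
move=> ab; apply: eq_bigr => v _; have [-> | gv] := eqVneq (g v) 0;
  first by rewrite !mul0r.
by have /andP[Zv v0] := g_support gv; rewrite ab.
Qed.

Let sum_indicator U : \sum_(v in U) g v = \sum_v g v * (v \in U)%:R.
Proof. by rewrite big_mkcond; apply: eq_bigr => v _;
  rewrite mulr_natr mulrb. Qed.

(** Interchanging the sums reduces every count of elements of [L] to counting maximal subspaces
    through one singular vector. *)
Let L_count (P : pred {vspace V}) :
  \sum_(tau in maximals | P tau) (tau \in L)%:R
    = \sum_v g v * #|[set tau in maximals | P tau & v \in tau]|%:R.
Proof.
rewrite (eq_bigr (fun tau => \sum_(v in tau) g v)); last first.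
  by move=> tau /andP[mtau _]; rewrite g_sum.
rewrite (exchange_big_dep predT) //=; apply: eq_bigr => v _.
rewrite sumr_const mulr_natr; congr (_ *+ _); apply: eq_card => tau.
by rewrite [LHS]unfold_in [RHS]in_set -andbA.
Qed.

(** Each nonzero singular vector lies in the same number of maximal subspaces, and [L_card] says
    that [L] has exactly that many elements. *)
Lemma total_weight : \sum_v g v = 1.
Proof.
have prod_gt0 : 0 < \prod_(j < d.-1) (1 + s * q ^+ j).
  by apply: prodr_gt0 => j _; rewrite addr_gt0 // mulr_gt0 // exprn_gt0.
apply: (mulIf (lt0r_neq0 prod_gt0)); rewrite mul1r -[in RHS]L_card.
have -> : #|L|%:R = \sum_(tau in maximals | true) (tau \in L)%:R :> R.
  rewrite -natr_sum; congr (_%:R);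
    rewrite -sum1_card big_mkcond [RHS]big_mkcond /=.
  apply: eq_bigr => tau _; rewrite andbT;
    case: (boolP (tau \in L)) => [/(subsetP L_maximal)-> // | _].
  by case: ifP.
rewrite L_count mulr_suml; apply: eq_weighted_sum => v Zv v0.
have := card_generators_through (singular_line Zv).
by rewrite dim_vline v0 subn1 generators_over_line0.
Qed.

Lemma L_intersecting pi sigma :
  pi \in L -> sigma \in L -> (sigma :&: pi)%VS != 0%VS.
Proof.
move=> piL sigmaL; have mpi := subsetP L_maximal _ piL.
have msigma := subsetP L_maximal _ sigmaL.
have : \sum_(tau in maximals | (tau :&: pi == 0)%VS) (tau \in L)%:R = 0 :> R.
  (* No subspace disjoint from [pi] contains a nonzero vector of [pi]; through any other singular
     [v] there are [opposite_number d.-1] of them. *)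
  rewrite L_count (eq_weighted_sum (b := fun v =>
    opposite_number d.-1 * (1 - (v \in pi)%:R))).
    under eq_bigr do rewrite mulrCA mulrBr mulr1.
    by rewrite -mulr_sumr sumrB total_weight -sum_indicator g_sum // piL subrr
      mulr0.
  move=> v Zv v0; case: (boolP (v \in pi)) => vpi.
    rewrite subrr mulr0; apply/eqP; rewrite pnatr_eq0 cards_eq0;
      apply/eqP/setP => tau.
    rewrite !inE; apply/negP => /and3P[_ /eqP tpi vtau]; case/negP: v0.
    by rewrite -memv0 -tpi memv_cap vtau.
  rewrite subr0 mulr1 -(card_generators_opposite_line Zv v0 mpi); congr (_%:R).
  apply: eq_card => tau; rewrite [LHS]in_set mem_generators_over -memvE;
    congr andb.
  rewrite andbC; apply: andb_id2l => vtau; apply/eqP/idP => [-> | sub];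
    first exact: sub0v.
  apply/eqP; rewrite -subv0; apply/subvP => x xtpi; rewrite memv0.
  have /vlineP[a xE] := subvP sub x xtpi.
  have [a0 | a0] := eqVneq a 0; first by rewrite xE a0 scale0r.
  case/negP: vpi; rewrite -(scalerK a0 v) -xE memvZ //.
  by move: xtpi; rewrite memv_cap => /andP[].
move/eqP; rewrite psumr_eq0 => [/allP/(_ sigma (mem_index_enum _)) | tau _];
  last exact: ler0n.
by rewrite msigma sigmaL /= oner_eq0 implybF.
Qed.

(** This is [K u] of the overview. For [u] in [pi] the line of [u] lies in [pi], and [pi] lies in
    [perp <[u]>]; subtracting [opposite_number d.-2] on [pi] leaves the correct count for each
    position of [v]. *)
Let local_weight u : R := \sum_v g v *
  (opposite_number d.-1 * (v \in <[u]>%VS)%:R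
   + opposite_number d.-2 * (v \in perp <[u]>)%:R).

Lemma count_meeting_in_point pi u : pi \in maximals -> u \in pi -> u != 0 ->
  \sum_(tau in maximals | (u \in tau) && (tau :&: pi <= <[u]>)%VS)
      (tau \in L)%:R
    = local_weight u - opposite_number d.-2 * (pi \in L)%:R.
Proof.
move=> mpi upi u0; have Zu := maximal_Z mpi upi.
rewrite L_count -g_sum // sum_indicator mulr_sumr -sumrB.
under [RHS]eq_bigr do rewrite mulrCA -mulrBr.
apply: eq_weighted_sum => v Zv v0; rewrite -addrA -mulrBr.
have [vu | vNu] := boolP (v \in <[u]>%VS).
  have vpi : v \in pi by apply: (subvP _ v vu); rewrite -memvE.
  rewrite vpi (maximal_perp mpi) // subrr mulr0 addr0 mulr1.
  rewrite -(card_generators_opposite_line Zu u0 mpi); congr (_%:R);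
    apply: eq_card => tau.
  rewrite [LHS]in_set mem_generators_over -memvE -!andbA;
    do 2!apply: andb_id2l => ?.
  by rewrite (subvP _ v vu) ?andbT // -memvE.
rewrite mulr0 add0r; have [vpi | vpi] := boolP (v \in pi).
  rewrite (maximal_perp mpi) // subrr mulr0.
  apply/eqP; rewrite pnatr_eq0 cards_eq0; apply/eqP/setP => tau;
    rewrite [LHS]in_set [RHS]in_set0.
  apply/negP => /and3P[_ /andP[_ /subvP sub] vtau]; case/negP: vNu.
  by apply: sub; rewrite memv_cap vtau.
rewrite subr0; have [vu | vu] := boolP (v \in perp <[u]>); last first.
  rewrite mulr0; apply/eqP; rewrite pnatr_eq0 cards_eq0; apply/eqP/setP => tau;
    rewrite [LHS]in_set [RHS]in_set0.
  apply/negP => /and3P[mtau /andP[utau _] vtau]; case/negP: vu.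
  exact: maximal_perp mtau _ _.
have vNupi : v \notin (<[u]> + 0)%VS by rewrite addv0.
have [suv duv] := generators_over_extend (singular_line Zu) Zv vu vNupi.
(* Such a [v] spans with [u] a singular plane of vector dimension 2, so this case is empty when
   [d = 1] and the truncation in [d.-2] does no harm. *)
have <- : #|generators_over (<[u]> + <[v]>) pi|%:R = opposite_number d.-2.
  by rewrite card_generators_opposite // duv dim_vline u0 subn2.
rewrite mulr1; congr (_%:R); apply: eq_card => tau.
rewrite [LHS]in_set mem_generators_over subv_add -!memvE -!andbA;
  do 2!apply: andb_id2l => ?.
rewrite andbC; apply: andb_id2l => vtau.
apply/idP/idP => [sub | /subvP sub]; first exact: subv_trans sub (addvSl _ _).
apply/subvP => x xtpi; have xpi : x \in pi by move: xtpi;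
  rewrite memv_cap => /andP[].
case/memv_addP: (sub x xtpi) => y yu [z /vlineP[a ->] xE].
have [a0 | a0] := eqVneq a 0; first by rewrite xE a0 scale0r addr0.
case/negP: vpi; have -> : v = a^-1 *: (- y + x) by rewrite xE addKr scalerK.
rewrite memvZ // rpredD // rpredN; apply: (subvP _ y yu); by rewrite -memvE.
Qed.

Lemma exists_heavy_point pi : pi \in L ->
  exists2 u, (u \in pi) && (u != 0) & opposite_number d.-2 < local_weight u.
Proof.
move=> piL; have mpi := subsetP L_maximal _ piL;
  have [spi dpi] := maximalsP _ mpi.
apply/exists_inP; apply: contraT; rewrite negb_exists_in => /forall_inP light.
set o2 := opposite_number d.-2 in light *; set o1 := opposite_number d.-1.
pose c : R := q ^+ d.-1 - 1.
have : \sum_(u in pi | u != 0) local_weight u <= \sum_(u in pi | u != 0) o2.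
  by apply: ler_sum => u upi; rewrite leNgt light.
rewrite sumr_const -[o2 *+ _]mulr_natl card_rowspace_neq0 dpi.
have -> : \sum_(u in pi | u != 0) local_weight u
  = o1 * (q - 1) + o2 * (q ^+ d - 1).
  rewrite /local_weight exchange_big /=.
  under eq_bigr do rewrite -mulr_sumr big_split /= -!mulr_sumr.
  (* A [v] in [pi] lies on the line of [q - 1] vectors [u] and is orthogonal to all [q ^+ d - 1]. A
     [v] outside lies on none and is orthogonal to [c] of them. The coefficient is thus affine in
     the indicator of [pi], whose weighted sum is 1 like the total weight, so [c] cancels. *)
  rewrite (eq_weighted_sum (b := fun v =>
      (o1 * (q - 1) + o2 * (q ^+ d - 1) - o2 * c) * (v \in pi)%:R + o2 * c)).
    under eq_bigr do rewrite mulrDr mulrCA.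
    rewrite big_split /= -mulr_sumr -sum_indicator g_sum // piL -mulr_suml
      total_weight mulr1 mul1r.
    by rewrite subrK.
  move=> v Zv v0.
  have -> : \sum_(u in pi | u != 0) (v \in perp <[u]>)%:R
            = q ^+ \dim (pi :&: perp <[v]>) - 1.
    rewrite -card_rowspace_neq0 -natr_sum -big_mkcondr sum1_card; congr (_%:R).
    by apply: eq_card => u; rewrite !inE memv_cap mem_perpC andbAC.
  have -> : \sum_(u in pi | u != 0) (v \in <[u]>%VS)%:R
    = (q - 1) * (v \in pi)%:R.
    have [vpi | vpi] := boolP (v \in pi); last first.
      rewrite mulr0 big1 // => u /andP[upi _]; case: (boolP (v \in _)) => // vu.
      by case/negP: vpi; apply: (subvP _ v vu); rewrite -memvE.
    have -> : q - 1 = #|[pred u in <[v]>%VS | u != 0]|%:R by rewrite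
      card_rowspace_neq0 dim_vline v0.
    rewrite mulr1 -natr_sum -big_mkcondr sum1_card; congr (_%:R).
    apply: eq_card => u; rewrite [LHS]unfold_in [RHS]inE.
    apply/andP/andP => [[/andP[_ u0] vu] | [uv u0]].
      by rewrite (vline_eqP v0 vu) memv_line.
    by rewrite (vline_eqP u0 uv) memv_line u0 andbT (subvP _ u uv) // -memvE.
  have [vpi | vpi] := boolP (v \in pi).
    rewrite (capv_idPl _) ?dpi ?mulr1 ?subrK //.
    by apply/subvP => u upi; apply: maximal_perp vpi upi.
  have := dim_perp_exchange pi <[v]>%VS; rewrite dim_vline v0 dpi.
  have -> : (<[v]> :&: perp pi)%VS = 0%VS.
    apply/eqP; rewrite -subv0; apply/subvP => x; rewrite memv_cap memv0.
    case/andP=> /vlineP[a ->] vperp; have [-> | a0] := eqVneq a 0;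
      first by rewrite scale0r.
    case/negP: vpi; apply: perp_maximal => //.
    by rewrite -(scalerK a0 v) memvZ.
  rewrite dimv0 => dE; rewrite (_ : \dim _ = d.-1); last by lia.
  by rewrite !mulr0 !add0r.
rewrite [X in _ <= X]mulrC gerDr leNgt mulr_gt0 // ?opposite_number_gt0 //
  subr_gt0.
by rewrite q_gt1.
Qed.

Theorem degree_one_set_is_pencil :
  exists2 u, Z u && (u != 0) & L = [set tau in maximals | u \in tau].
Proof.
have L_gt0 : (0 < #|L|)%N.
  rewrite -(ltr0n R) L_card; apply: prodr_gt0 => j _.
  by rewrite addr_gt0 // mulr_gt0 // exprn_gt0.
have [pi piL] := card_gt0P L_gt0; have mpi := subsetP L_maximal _ piL.
have [u /andP[upi u0] heavy] := exists_heavy_point piL.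
have Zu := maximal_Z mpi upi; exists u; first by rewrite Zu.
apply/eqP; rewrite eqEcard; apply/andP; split; last first.
  rewrite -(ler_nat R) L_card -generators_over_line0 card_generators_through
    ?singular_line //.
  by rewrite dim_vline u0 subn1.
apply/subsetP => sigma sigmaL; have msigma := subsetP L_maximal _ sigmaL.
rewrite in_set msigma /=; apply: contraLR heavy => uNsigma; rewrite -leNgt.
pose sigma' := (<[u]> + (sigma :&: perp <[u]>))%VS.
have msigma' : sigma' \in maximals by rewrite maximal_proj ?singular_line.
have usigma' : u \in sigma' by rewrite memvE addvSl.
have := count_meeting_in_point msigma' usigma' u0.
rewrite big1 => [/esym/eqP | tau /andP[mtau /andP[utau sub]]].
  rewrite subr_eq0 => /eqP ->;
    rewrite ler_piMr ?(ltW (opposite_number_gt0 _)) //.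
  by rewrite lern1 leq_b1.
case: (boolP (tau \in L)) => // tauL.
(* A vector [x] of [tau] and [sigma] is orthogonal to [u], since [tau] contains both. Hence it lies
   in [sigma'], so on the line of [u], which meets [sigma] only in 0. *)
have := L_intersecting sigmaL tauL; case/negP; rewrite -subv0; apply/subvP => x.
rewrite memv_cap => /andP[xtau xsigma]; rewrite memv0.
have /(subvP sub)/vlineP[a xE] : x \in (tau :&: sigma')%VS.
  rewrite memv_cap xtau (subvP (addvSr _ _)) // memv_cap xsigma.
  exact: maximal_perp mtau _ _.
have [a0 | a0] := eqVneq a 0; first by rewrite xE a0 scale0r.
by case/negP: uNsigma; rewrite -(scalerK a0 u) -xE memvZ.
Qed.

End CameronLieblerSet.
End PolarGeometry.

(** * From weights on points to weights on singular vectors *)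

Lemma pencil_of_geometry (F : finFieldType) (n : nat) (phi : polar_form F n)
    (theta : {rmorphism F -> F}) (B : 'rV[F]_n -> 'rV[F]_n -> F)
    (Z : pred 'rV[F]_n) (rho d : nat) (R : realType) (s : R)
    (L : {set {vspace 'rV[F]_n}}) :
  polar_geometry theta B Z rho ->
  totally_isotropic phi =1 singular_subspace B Z ->
  polar_rank phi = d -> (0 < d)%N ->
  s * #|F|%:R ^+ d.-1 * rho%:R = #|F|%:R ^+ (n - d) ->
  degree_one_CL phi R L ->
  #|L|%:R = \prod_(j < d.-1) (1 + s * #|F|%:R ^+ j) ->
  exists2 p, p \in points phi & L = point_pencil phi p.
Proof.
move=> pg tiE rk d_gt0 s_rho [LG [w chiE]] L_card.
have le_d U : singular_subspace B Z U -> (\dim U <= d)%N.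
  by rewrite -tiE -rk => tiU; apply: leq_bigmax_cond.
have max_d : exists2 U, singular_subspace B Z U & \dim U = d.
  have ti0 : (0 < #|totally_isotropic phi|)%N.
    apply/card_gt0P; exists 0%VS; suff : totally_isotropic phi 0%VS by [].
    rewrite tiE; apply/singular_subspaceP; split=> [x | x y];
      rewrite !memv0 => /eqP->.
      exact: pg_Z0 pg.
    by rewrite (polar0l pg).
  have [U tiU rkU] := eq_bigmax_cond (fun U : {vspace 'rV[F]_n} => \dim U) ti0.
  by exists U; rewrite -?tiE // -rkU -rk.
have gensE : generators phi = maximals B Z d.
  by apply/setP => U; rewrite !inE tiE rk.
set q : R := #|F|%:R.
have q1 : q - 1 != 0 by rewrite subr_eq0 gt_eqF // ltr1n finNzRing_gt1.
(* The weight of each point is spread evenly over its [q - 1] nonzero vectors. *)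
pose g v : R := \sum_i ((enum_val i == <[v]>%VS)%:R * w i 0) / (q - 1).
have g_support v : g v != 0 -> Z v && (v != 0).
  apply: contraNT => Nv; rewrite /g big1 // => i _.
  have := enum_valP i; rewrite inE; case: (enum_val i =P <[v]>%VS) => [-> | _];
    last by rewrite !mul0r.
  rewrite dim_vline tiE => /andP[/singular_subspaceP[Zv _]].
  by move: Nv; rewrite Zv ?memv_line //=; case: (v != 0).
have g_sum : {in maximals B Z d, forall tau : {vspace 'rV[F]_n},
      \sum_(v in tau) g v = (tau \in L)%:R}.
  move=> tau; rewrite -gensE => tauG.
  have := congr1
    (fun c : 'cV[R]_#|generators phi| => c (enum_rank_in tauG tau) 0) chiE.
  rewrite !mxE enum_rankK_in // => ->.
  rewrite exchange_big /=; apply: eq_bigr => i _; rewrite !mxE enum_rankK_in //.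
  rewrite -mulr_suml -mulr_suml; apply: (canLR (mulfK q1)).
  rewrite mulrAC [RHS]mulrC mulrC; congr (_ * _).
  have := enum_valP i; set p := enum_val i; rewrite inE => /andP[_ /eqP dp].
  have pE v : (p == <[v]>%VS) = (v \in p) && (v != 0).
    apply/eqP/andP => [pv | [vp v0]].
      by move: dp; rewrite pv dim_vline memv_line; case: (v != 0).
    by apply/esym/eqP; rewrite eqEdim -memvE vp dim_vline v0 dp.
  rewrite -natr_sum -big_mkcondr sum1_card.
  have [/subvP pt | pt] := boolP (p <= tau)%VS.
    have -> : q - 1 = #|[pred v in p | v != 0]|%:R.
      by rewrite card_rowspace_neq0 dp.
    rewrite mul1r; congr (_%:R); apply: eq_card => v.
    by rewrite [LHS]unfold_in [RHS]inE pE andb_idl // => /andP[/pt].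
  rewrite mul0r; apply/eqP; rewrite pnatr_eq0; apply/eqP/eq_card0 => v.
  rewrite [LHS]unfold_in; apply/negP => /andP[vtau /eqP pv].
  by case/negP: pt; rewrite pv -memvE.
rewrite gensE in LG.
have [u /andP[Zu u0] LE] :=
  degree_one_set_is_pencil pg le_d max_d d_gt0 s_rho LG g_support g_sum L_card.
exists <[u]>%VS; first by rewrite inE tiE (singular_line pg) // dim_vline u0.
by rewrite LE; apply/setP => tau; rewrite [LHS]in_set [RHS]in_set gensE memvE.
Qed.

(** * Quadratic, symplectic and Hermitian forms as polar geometries *)

Lemma quadratic_geometry (F : finFieldType) (n : nat) (Q : 'rV[F]_n -> F) :
  is_quadratic Q -> nonsingular Q ->
  exists2 B, polar_geometry idfun B (fun v => Q v == 0) #|F| &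
    totally_isotropic (QuadraticForm Q)
      =1 singular_subspace B (fun v => Q v == 0).
Proof.
move=> [QZ [B QD]] ns.
have Q0 : Q 0 = 0 by rewrite -(scale0r 0) QZ expr0n mul0r.
have BE u v : B u v = Q (u + v) - Q u - Q v by rewrite QD; ring.
have BC u v : B u v = B v u by rewrite !BE [v + u]addrC addrAC.
have Bself u : Q u = 0 -> B u u = 0.
  by move=> Qu; rewrite BE -[u in u + u]scale1r -scalerDl QZ Qu; ring.
exists B; first split.
- by move=> a u v w; rewrite linearDl linearZl_LR.
- by move=> w a u v; rewrite linearDr linearZr_LR.
- by move=> u v; rewrite BC.
- by rewrite Q0.
- by move=> a u /eqP Qu; rewrite QZ Qu mulr0.
- by move=> u v /eqP Qu /eqP Qv uv; rewrite QD Qu Qv uv !addr0.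
- by move=> u /eqP /Bself.
- by move=> v /eqP Qv vV; apply: ns => // u; rewrite -(vV u) BE; ring.
(* As [Q] vanishes on [U], [Q (v + y)] is [Q v + B v y]: the singular vectors of the coset
   correspond to a single fibre of [B v], whence [rho = #|F|]. *)
- move=> U v ZU _ [x xU vx].
  rewrite -(@semilinear_fiber_card F n idfun U (B v) (- Q v)).
  + congr muln; apply: eq_card => y; rewrite !inE; apply: andb_id2l => yU.
    by rewrite QD (eqP (ZU y yU)) addr0 addrC addr_eq0.
  + by move=> a u y; rewrite linearDr linearZr_LR.
  + by exists x.
move=> U; apply/forallP/singular_subspaceP => [ZU | [ZU _] v].
  have {}ZU x : x \in U -> Q x = 0 by move=> xU; apply/eqP;
    move/implyP: (ZU x); apply.
  split=> [x /ZU -> // | x y xU yU]; by rewrite BE !ZU ?rpredD // !subr0.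
by apply/implyP => /ZU.
Qed.

Lemma orthov_singular (F : finFieldType) (n : nat) (eps : bool)
    (theta : {rmorphism F -> F}) (H : {hermitian 'rV[F]_n for eps & theta})
    (Z : pred 'rV[F]_n) (U : {vspace 'rV[F]_n}) :
  (forall v, H v v = 0 -> Z v) -> (U <= orthov H U)%VS
    = singular_subspace H Z U.
Proof.
move=> HZ; apply/orthovP/singular_subspaceP => [HU | [_ HU]] //.
by split=> // x xU; apply: HZ; apply: HU.
Qed.

(** Every vector is singular, so whole cosets are and [rho] is 1. *)
Lemma symplectic_geometry (F : finFieldType) (n : nat)
    (B : {skew_symmetric 'rV[F]_n}) :
  is_psymplectic B -> polar_geometry idfun B xpredT 1.
Proof.
move=> [/eqP nd _ char2].
have Bself u : B u u = 0.
  have [two | two] := boolP (2%N \in [pchar F]); first exact: char2.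
  have : B u u *+ 2 = 0 by rewrite mulr2n [X in X + _](hermC B) expr1 mulN1r
    addNr.
  rewrite -mulr_natr => /eqP; rewrite mulf_eq0 => /orP[/eqP // | two0].
  by case/negP: two; rewrite inE.
split=> //.
- by move=> a u v w; rewrite linearDl linearZl_LR.
- by move=> w a u v; rewrite linearDr linearZr_LR.
- by move=> u v; rewrite (herm_eq0C B).
- by move=> v _ vV; apply/eqP; rewrite -memv0 -nd; apply/mem_orthovP => u _;
  apply: vV.
- by move=> U v _ _ _; rewrite mul1n; apply: eq_card => x;
  rewrite [LHS]inE andbT.
Qed.

(* The fibres of the trace [t |-> t + t ^ r] over the at most [r] elements
   fixed by [t |-> t ^ r] have at most [r] elements each, and there are [r ^ 2]
   elements to distribute. *)
Lemma trace_fiber_card (F : finFieldType) (r : nat) (c : F) :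
  #|F| = (r ^ 2)%N -> (forall x y : F, (x + y) ^+ r = x ^+ r + y ^+ r) ->
  c ^+ r = c -> #|[pred t : F | (t + t ^+ r)%R == c]| = r.
Proof.
move=> Fr frobD cr.
have r_gt1 : (1 < r)%N.
  by have := finNzRing_gt1 F; rewrite Fr -{1}(exp1n 2) ltn_exp2r.
have rootP (p : {poly F}) : size p = r.+1 -> (#|[pred t | root p t]| <= r)%N.
  move=> sp; rewrite cardE -ltnS -sp; apply: max_poly_roots.
  - by rewrite -size_poly_eq0 sp.
  - by apply/allP => t; rewrite mem_enum.
  - exact: enum_uniq.
have fib_le a : (#|[pred t : F | (t + t ^+ r)%R == a]| <= r)%N.
  have := @rootP ('X^r + ('X - a%:P)) _.
  rewrite size_polyDl size_polyXn ?size_XsubC // => /(_ erefl);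
    congr (_ <= _)%N.
  apply: eq_card => t; rewrite [LHS]inE [RHS]inE rootE !hornerD hornerXn
    hornerX hornerN hornerC.
  by rewrite addrA subr_eq0 addrC.
have fix_le : (#|[pred a : F | a ^+ r == a]| <= r)%N.
  have := @rootP ('X^r - 'X) _.
  rewrite size_polyDl size_polyXn ?size_polyN ?size_polyX // => /(_ erefl);
    congr (_ <= _)%N.
  by apply: eq_card => t;
    rewrite !inE rootE hornerD hornerN hornerXn hornerX subr_eq0.
have trP (t : F) : (t + t ^+ r) ^+ r == t + t ^+ r.
  by rewrite frobD -exprM -[(r * r)%N]/(r ^ 2)%N -Fr expf_card addrC.
apply/eqP; rewrite eqn_leq fib_le /=.
have : (r ^ 2 = \sum_(a : F | a ^+ r == a) #|[pred t :
  F | (t + t ^+ r)%R == a]|)%N.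
  rewrite -Fr -sum1_card (partition_big (fun t => t + t ^+ r) (fun a =>
    a ^+ r == a)) //=.
  by apply: eq_bigr => a _; rewrite -sum1_card.
rewrite (bigD1 c) /= ?cr //; set S := (\sum_(_ | _) _)%N.
have : (S <= r.-1 * r)%N.
  apply: (@leq_trans (\sum_(a : F | (a ^+ r == a) && (a != c)) r)%N).
    by apply: leq_sum => a _; apply: fib_le.
  rewrite sum_nat_const leq_mul2r; apply/orP; right.
  move: fix_le; rewrite (cardD1 c [pred a | _]) inE cr eqxx => le.
  rewrite -ltnS prednK ?(ltnW r_gt1) //; apply: leq_trans le; rewrite ltnS.
  by apply: subset_leq_card; apply/subsetP => a; rewrite !inE andbC.
case: r r_gt1 {Fr frobD cr rootP fib_le fix_le trP} S => // r _ S; rewrite /=.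
move: #|_| => N; nia.
Qed.

(** For [x] in [U] and [t = H v x], the norm of [v + x] is [H v v + t + t ^+ r]. By
    [trace_fiber_card] it vanishes for [r] values of [t], each taken on a fraction [1 / r ^ 2] of
    [U]; hence [rho = r]. *)
Lemma hermitian_geometry (F : finFieldType) (n r : nat)
    (theta : {rmorphism F -> F}) (H : {hermitian_sym 'rV[F]_n for theta}) :
  #|F| = (r ^ 2)%N -> (forall x, theta x = x ^+ r) -> is_unitary H ->
  polar_geometry theta H (fun v => H v v == 0) r.
Proof.
move=> Fr thetaE [/eqP nd _].
have HC u v : H u v = theta (H v u) by rewrite (hermC H) expr0 mul1r.
split.
- by move=> a u v w; rewrite linearDl linearZl_LR.
- by move=> w a u v; rewrite linearDr linearZr_LR.
- by move=> u v; rewrite (herm_eq0C H).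
- by rewrite linear0l.
- by move=> a u /eqP Hu; rewrite linearZl_LR linearZr_LR /= Hu !mulr0.
- by move=> u v /eqP Hu /eqP Hv uv; rewrite (hnormDd uv) Hu Hv addr0.
- by move=> u /eqP.
- by move=> v _ vV; apply/eqP; rewrite -memv0 -nd; apply/mem_orthovP => u _;
  apply: vV.
move=> U v ZU _ [x0 x0U vx0].
have r_gt0 : (0 < r)%N by case: r Fr {thetaE} => // F0;
  have := finNzRing_gt1 F; rewrite F0.
have fr (x y : F) : (x + y) ^+ r = x ^+ r + y ^+ r by rewrite -!thetaE rmorphD.
have trE := trace_fiber_card (c := - H v v) Fr fr.
have {}trE : #|[pred t : F | (t + t ^+ r)%R == - H v v]| = r.
  by apply: trE; rewrite -thetaE rmorphN -HC.
have fibE t : (#|F| * #|[pred x in U | H v x == t]|)%N = #|U|.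
  apply: (@semilinear_fiber_card F n theta); last by exists x0.
  by move=> a u y; rewrite linearDr linearZr_LR.
have -> : #|[pred x in U | (H (v + x) (v + x) == 0)%R]|
   = (\sum_(t : F | (t + t ^+ r == - H v v)%R) #|[pred x in U | H v x == t]|)%N.
  rewrite -sum1_card (partition_big (H v) (fun t => t + t ^+ r == - H v v)) /=.
    apply: eq_bigr => t /eqP tE; rewrite sum1_card; apply: eq_card => x.
    rewrite [LHS]unfold_in !inE; case: (boolP (x \in U)) => //= xU.
    case: (H v x =P t) => [vxt | _];
      rewrite ?andbF // andbT hnormD (eqP (ZU x xU)) addr0.
    by rewrite expr0 mul1r thetaE vxt tE subrr eqxx.
  move=> x; rewrite inE => /andP[xU]; rewrite hnormD (eqP (ZU x xU)) addr0.
  by rewrite expr0 mul1r thetaE addrC addr_eq0.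
apply/eqP; rewrite -(eqn_pmul2l (r_gt0)) mulnA -[(r * r)%N]/(r ^ 2)%N -Fr
  big_distrr /=.
by rewrite (eq_bigr (fun=> #|U|)) // sum_nat_const trE.
Qed.

(** * Exponents and ambient dimensions of the six families *)

Theorem theorem5p4 (R : realType) (F : finFieldType) (t : polar_type) (d : nat)
    (phi : polar_form F (ambient_dim t d)) (d_gt0 : (0 < d)%N)
    (phiP : classical_polar_space phi)
    (L : {set {vspace 'rV[F]_(ambient_dim t d)}})
    (L_CL : degree_one_CL phi R L)
    (L_param : CL_parameter R t d L = 1%R) :
  exists2 p : {vspace 'rV[F]_(ambient_dim t d)},
    p \in points phi & L = point_pencil phi p.
Proof.
have q_gt0 : 0 < #|F|%:R :> R by rewrite ltr0n ltnW ?finNzRing_gt1.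
have L_card : #|L|%:R
  = \prod_(j < d.-1) (1 + #|F|%:R `^ polar_e R t * #|F|%:R ^+ j).
  have -> : \prod_(j < d.-1) (1 + #|F|%:R `^ polar_e R t * #|F|%:R ^+ j)
          = \prod_(k < d.-1) (#|F|%:R `^ (polar_e R t + k%:R) + 1).
    apply: eq_bigr => k _; rewrite addrC powRD ?(gt_eqF q_gt0) ?implybT //.
    by rewrite powR_mulrn // ltW.
  move: L_param; rewrite /CL_parameter => /(canRL (divfK _)); rewrite mul1r;
    apply.
  rewrite gt_eqF //; apply: prodr_gt0 => k _.
  by rewrite addr_gt0 // powR_gt0.
case: phiP => phiP rk; set s := _ `^ _ in L_card.
have geometry theta B Z rho :
    s * #|F|%:R ^+ d.-1 * rho%:R = #|F|%:R ^+ (ambient_dim t d - d) ->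
    polar_geometry theta B Z rho ->
    totally_isotropic phi =1 singular_subspace B Z ->
    exists2 p : {vspace 'rV[F]_(ambient_dim t d)},
      p \in points phi & L = point_pencil phi p.
  by move=> s_rho pg tiE; apply: (pencil_of_geometry pg tiE rk d_gt0 s_rho).
have integral_e k : polar_e R t = k%:R -> ambient_dim t d = (d + (k + d))%N ->
    s * #|F|%:R ^+ d.-1 * #|F|%:R = #|F|%:R ^+ (ambient_dim t d - d).
  move=> ek ->; rewrite addKn /s ek powR_mulrn ?ltW // -mulrA -exprSr prednK //.
  by rewrite exprD.
(* In the Hermitian families [q ^ (1/2)] is [r], so multiplying by [rho = r] makes the exponent
   integral. *)
have half_integral_e r k : #|F| = (r ^ 2)%N -> polar_e R t = k%:R + 2^-1 ->
    ambient_dim t d = (d + (k + d))%N ->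
    s * #|F|%:R ^+ d.-1 * r%:R = #|F|%:R ^+ (ambient_dim t d - d).
  move=> Fr ek ->; rewrite addKn /s ek powRD ?(gt_eqF q_gt0) ?implybT //.
  rewrite powR_mulrn ?ltW // powR12_sqrt ?ltW // {2}Fr natrX sqrtr_sqr
    ger0_norm ?ler0n //.
  by rewrite -mulrA mulrACA -expr2 -(natrX R r 2) -Fr -mulrA -exprSr prednK //
    exprD.
have symplectic_e : polar_e R t = 1 -> ambient_dim t d = d.*2 ->
    s * #|F|%:R ^+ d.-1 * 1%:R = #|F|%:R ^+ (ambient_dim t d - d).
  by move=> e1 ->; rewrite -addnn addKn /s e1 powRr1 ?ltW // mulr1 -exprS
    prednK.
move: s L_card geometry integral_e half_integral_e symplectic_e =>
  s _ {rk L_CL L_param}.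
(* A form of the wrong kind for its type makes [defines_type] false, so six cases remain. *)
case: t phi L phiP => -[Q | B | theta H] L //= phiP geometry
  integral_e half_integral_e symplectic_e; try by [].
- have [B pg tiE] := quadratic_geometry phiP.1 phiP.2.
  by apply: geometry pg tiE; apply: (integral_e 0%N) => //; rewrite -addnn.
- have [[r Fr thetaE] H_unitary] := phiP.
  apply: geometry (hermitian_geometry Fr thetaE H_unitary) _.
    by apply: (half_integral_e r 0%N) => //; rewrite ?add0r ?mul1r // -addnn.
  by move=> U; apply: orthov_singular => v ->.
- apply: geometry (symplectic_geometry phiP) _; first exact: symplectic_e.
  by move=> U; apply: orthov_singular.
- have [B pg tiE] := quadratic_geometry phiP.1 phiP.2.
  by apply: geometry pg tiE; apply: (integral_e 1%N) => //; rewrite -addnn; lia.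
- have [[r Fr thetaE] H_unitary] := phiP.
  apply: geometry (hermitian_geometry Fr thetaE H_unitary) _.
    by apply: (half_integral_e r 1%N) => //; [field | rewrite -addnn; lia].
  by move=> U; apply: orthov_singular => v ->.
- have [B pg tiE] := quadratic_geometry phiP.1 phiP.2.
  by apply: geometry pg tiE; apply: (integral_e 2%N) => //; rewrite -addnn; lia.
Qed.
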